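(* Assume $\mathrm{cov}(\mathcal N)>\omega_1$. Then there is a compact space $S$ with $t_0(S)>\omega$ such that $t_0(L)=\omega$ for every continuous image $L$ of $S$ of weight $\omega_1$.
   Context: All topological spaces are Hausdorff. $\mathcal N$ is the ideal of Lebesgue null subsets of $[0,1]$, and $\mathrm{cov}(\mathcal N)>\omega_1$ means that $[0,1]$ cannot be covered by $\omega_1$ many sets from $\mathcal N$. For a topological space $X$ and an (infinite) cardinal $\kappa$, write $t_0(X)\le\kappa$ if every function $f:X\to\mathbb R$ is continuous provided $f|_Y:Y\to\mathbb R$ is continuous for every subspace $Y\subseteq X$ with $|Y|\le\kappa$. The functional tightness $t_0(X)$ is the least infinite cardinal $\kappa$ such that $t_0(X)\le\kappa$. The weight of a space is the minimal size of a base. *)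

(* Defs.v *)
From mathcomp Require Import all_boot all_order all_algebra.
From mathcomp Require Import all_classical all_reals all_analysis.
Set Implicit Arguments.
Unset Strict Implicit.
Unset Printing Implicit Defensive.
Import Order.TTheory GRing.Theory Num.Theory.
Import numFieldNormedType.Exports.
Local Open Scope classical_set_scope.
Local Open Scope card_scope.
Local Open Scope ring_scope.

(* Cardinals are represented by arbitrary sets, compared with the library's
   [#<=] and [#=]. In particular omega is represented by [set: nat], and
   omega_1 is the least uncountable cardinal. *)
Definition card_le_omega1 (T : Type) (A : set T) : Prop :=
  forall (U : Type) (B : set U), ~ countable B -> A #<= B.

Definition card_eq_omega1 (T : Type) (A : set T) : Prop :=
  ~ countable A /\ card_le_omega1 A.

(* The library's [negligible] allows non-Borel sets contained in a Borel set of
   measure 0, so these are exactly the Lebesgue null subsets of [0, 1]. *)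
Definition null_ideal (R : realType) : set (set R) :=
  [set N | N `<=` `[0, 1]%classic /\ (@lebesgue_measure R).-negligible N].
Arguments null_ideal : clear implicits.

Definition cov_null_gt_omega1 (R : realType) : Prop :=
  forall F : set (set R), F `<=` null_ideal R -> card_le_omega1 F ->
    ~ (`[0, 1]%classic `<=` \bigcup_(N in F) N).

Definition functional_tightness_le (R : realType) (X : topologicalType)
    (T : Type) (K : set T) : Prop :=
  forall f : X -> R,
    (forall Y : set X, Y #<= K -> {within Y, continuous f}) -> continuous f.

Definition functional_tightness_eq (R : realType) (X : topologicalType)
    (T : Type) (K : set T) : Prop :=
  [/\ infinite_set K, functional_tightness_le R X K &
      forall (U : Type) (K' : set U),
        infinite_set K' -> functional_tightness_le R X K' -> K #<= K'].

Definition weight_eq (X : topologicalType) (T : Type) (K : set T) : Prop :=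
  (exists2 B : set (set X), basis B & B #= K) /\
  (forall B : set (set X), basis B -> K #<= B).

Definition weight_eq_omega1 (X : topologicalType) : Prop :=
  exists (T : Type) (K : set T), card_eq_omega1 K /\ weight_eq X K.

Definition continuous_image (X Y : topologicalType) : Prop :=
  exists2 g : X -> Y, continuous g & set_surj setT setT g.

(* Main.v *)
Require Import Defs.
From mathcomp Require Import all_boot all_order all_algebra.
From mathcomp Require Import all_classical all_reals all_analysis.
From mathcomp Require Import measurable_realfun lra.
From HB Require Import structures.
Import Order.TTheory GRing.Theory Num.Theory.
Import numFieldNormedType.Exports.
Local Open Scope classical_set_scope.
Local Open Scope ring_scope.

(** The space [S] is the Stone space of the measure algebra of the real line,
    that is, of the Borel sets modulo Lebesgue null sets.

    Its functional tightness is uncountable. Let [O] be the set of the points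
    (ultrafilters) of [S] that contain a set of finite measure. It is open and
    dense ([finite_part_dense]) but is not the whole space
    ([finite_part_neqT]), so its indicator is discontinuous. However, if [Y] is
    a countable subset of [O], then a single set [a] of finite measure belongs
    to all the points of [Y]: a point of [O] contains sets of arbitrarily small
    measure ([stone_finite_small]), and the union of a sequence of sets of
    measures at most [2^-(n+1)] has finite measure ([stone_countable_small]).
    Hence on a countable set the indicator of [O] agrees with the indicator of
    the clopen set defined by some [a], and is continuous there.

    A separable space has countable functional tightness
    ([separable_functional_tightness]), so it remains to see that every
    continuous image [L] of [S] whose weight is omega_1 is separable
    ([image_separable]). For each real [x] choose a point [y x] of [S] that
    contains all the sets of density 1 at [x]. By the Lebesgue density theorem
    a non-null set [A] belongs to [y x] for almost every [x] in [A]. Moreover,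
    for almost every [r] in [0, 1], some affine map with rational coefficients
    sends [r] to a density point of [A] ([negligible_affine_not_density_point]).
    Each nonempty open set of a base of [L] contains the image of the clopen
    set of some non-null [A]. As [0, 1] is not covered by omega_1 null sets, a
    single [r] works for all the members of the base, and the images in [L] of
    the points [y (c * r + d)], with [c] and [d] rational, form a countable
    dense set. *)

(** * The Stone space of a measure algebra *)

Section stone_space.
Set Implicit Arguments.
Unset Strict Implicit.
Context d (T : measurableType d) (R : realType).
Variable mu : {measure set T -> \bar R}.

(** The Stone space of the measure algebra of [mu]. A point is an ultrafilter
    of the Boolean algebra of measurable sets modulo null sets, encoded by the
    family of all measurable sets whose class belongs to it: such a family
    contains no null set, is stable under finite intersections, and contains
    each measurable set or its complement. *)
Record stone : Type := Stone {
  stone_mem :> set T -> Prop;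
  stone_measurable : forall A, stone_mem A -> measurable A;
  stone_neq0 : forall A, stone_mem A -> mu A != 0%E;
  stoneI : forall A B, stone_mem A -> stone_mem B -> stone_mem (A `&` B);
  stone_total : forall A, measurable A -> stone_mem A \/ stone_mem (~` A) }.

Lemma stoneN (y : stone) A : y A -> ~ y (~` A).
Proof.
by move=> yA /(stoneI yA)/stone_neq0; rewrite setICr measure0 eqxx.
Qed.

Lemma stoneS (y : stone) A B : measurable B -> A `<=` B -> y A -> y B.
Proof.
move=> mB AB yA; case: (stone_total y mB) => // /(stoneI yA)/stone_neq0.
have -> : A `&` ~` B = set0 by apply/disjoints_subset; rewrite setCK.
by rewrite measure0 eqxx.
Qed.

Lemma stoneT (y : stone) : y setT.
Proof.
case: (stone_total y measurableT) => // /stone_neq0.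
by rewrite setCT measure0 eqxx.
Qed.

Lemma stoneC (y : stone) A : measurable A -> ~ y A -> y (~` A).
Proof. by move=> /(stone_total y)[]. Qed.

(** Ultrafilters are maximal, so an inclusion between points is an equality. *)
Lemma stone_ext (y z : stone) : stone_mem y `<=` stone_mem z -> y = z.
Proof.
move=> yz; have e : stone_mem y = stone_mem z.
  apply/seteqP; split => // A zA; have mA := stone_measurable zA.
  by case: (stone_total y mA) => // /yz /(stoneN zA).
by case: y z e {yz} => ? ? ? ? ? [? ? ? ? ?] /= e; subst; congr Stone;
  exact: Prop_irrelevance.
Qed.

HB.instance Definition _ := gen_eqMixin stone.
HB.instance Definition _ := gen_choiceMixin stone.

(** The clopen set of the points that contain [A]. For [A] measurable these
    sets are taken as a base of the topology, so that compactness needs no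
    embedding in a product. *)
Definition stone_clopen (A : set T) : set stone := [set y | y A].

Let stone_cover : \bigcup_(A in measurable) stone_clopen A = setT.
Proof.
by apply/seteqP; split => // y _; exists setT => //; exact: stoneT.
Qed.

Let stone_join A B y : measurable A -> measurable B ->
  stone_clopen A y -> stone_clopen B y -> exists C, [/\ measurable C,
    stone_clopen C y & stone_clopen C `<=` stone_clopen A `&` stone_clopen B].
Proof.
move=> mA mB yA yB; exists (A `&` B); split.
- exact: measurableI.
- exact: stoneI.
- by move=> z zAB; split; apply: stoneS zAB.
Qed.

HB.instance Definition _ :=
  isBaseTopological.Build stone stone_cover stone_join.

Lemma nbhs_stone_clopen (y : stone) A : y A -> nbhs y (stone_clopen A).
Proof.
move=> yA; exists (stone_clopen A); split => //.
exists [set A]; first by move=> _ ->; exact: stone_measurable yA.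
by rewrite bigcup_set1.
Qed.

Lemma nbhs_stone (y : stone) W :
  nbhs y W -> exists2 A, y A & stone_clopen A `<=` W.
Proof.
move=> [_ [[D Dm <-] [A DA yA] DW]]; exists A => //.
by move=> z zA; apply: DW; exists A.
Qed.

Lemma hausdorff_stone : hausdorff_space stone.
Proof.
move=> y z yz; apply: stone_ext => A yA; apply: contrapT => zA.
have mA := stone_measurable yA.
have [x []] := yz _ _ (nbhs_stone_clopen yA) (nbhs_stone_clopen (stoneC mA zA)).
exact: stoneN.
Qed.

Lemma compact_stone : compact [set: stone].
Proof.
rewrite compact_ultra => F FU _.
(* The limit of an ultrafilter F on the Stone space consists of the measurable
   sets whose clopen set belongs to F. *)
pose p := [set A | measurable A /\ F (stone_clopen A)].
have p1 A : p A -> measurable A by case.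
have p2 A : p A -> mu A != 0%E.
  by move=> [_ /filter_ex[y /stone_neq0]].
have p3 A B : p A -> p B -> p (A `&` B).
  move=> [mA FA] [mB FB]; split; first exact: measurableI.
  by apply: filterS2 FA FB => y; exact: stoneI.
have p4 A : measurable A -> p A \/ p (~` A).
  move=> mA; have [FA|FA] := in_ultra_setVsetC (stone_clopen A) FU.
    by left.
  right; split; first exact: measurableC.
  by apply: filterS FA => y; exact: stoneC.
exists (Stone p1 p2 p3 p4); split => // W /nbhs_stone[A [_ FA] AW].
exact: filterS FA.
Qed.

(** A downward directed family of non-null measurable sets is contained in a
    point: take an ultrafilter of arbitrary subsets of [T] containing the
    family and every conull set, and keep its measurable members. *)
Lemma stone_ex (G : set (set T)) : G !=set0 ->
  (forall A, G A -> measurable A /\ mu A != 0%E) ->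
  (forall A B, G A -> G B -> exists2 C, G C & C `<=` A `&` B) ->
  exists y : stone, G `<=` stone_mem y.
Proof.
move=> [A0 GA0] Gm Gdir.
pose F := [set X | exists2 A, G A & mu.-negligible (A `\` X)].
have FF : ProperFilter F.
  apply: Build_ProperFilter_ex.
    move=> X [A GA nAX]; apply: contrapT => /set0P/negP/negPn/eqP X0.
    move: nAX; rewrite X0 setD0 => /measure_negligible.
    by have [mA /eqP mA0] := Gm _ GA => /(_ mA)/mA0.
  split.
  - by exists A0 => //; rewrite setDT; exact: negligible_set0.
  - move=> X Y [A GA nA] [B GB nB]; have [C GC CAB] := Gdir _ _ GA GB.
    exists C => //; apply: negligibleS (negligibleU nA nB) => x [Cx XYx].
    have [Ax Bx] := CAB _ Cx.
    by case: (pselect (X x)) => Xx; [right|left]; split => // Yx; apply: XYx.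
  - move=> X Y XY [A GA nA]; exists A => //.
    by apply: negligibleS nA => x [Ax Yx]; split => // /XY.
have [H [HU FH]] := ultraFilterLemma FF.
pose p := [set A | measurable A /\ H A].
have p1 A : p A -> measurable A by case.
have p2 A : p A -> mu A != 0%E.
  move=> [mA HA]; apply/eqP => A0'.
  have : H (~` A).
    apply: FH; exists A0 => //; rewrite setDE setCK.
    apply: negligibleS (_ : mu.-negligible A); last exact/negligibleP.
    by move=> ? [].
  by move=> /(filterI HA)/filter_ex[x []].
have p3 A B : p A -> p B -> p (A `&` B).
  by move=> [mA FA] [mB FB]; split; [exact: measurableI|exact: filterI].
have p4 A : measurable A -> p A \/ p (~` A).
  move=> mA; have [FA|FA] := in_ultra_setVsetC A HU; [by left|right].
  by split => //; exact: measurableC.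
exists (Stone p1 p2 p3 p4) => A GA; split; first by case: (Gm _ GA).
by apply: FH; exists A => //; rewrite setDv; exact: negligible_set0.
Qed.

Lemma stone_clopen_neq0 A : measurable A -> mu A != 0%E ->
  exists y : stone, y A.
Proof.
move=> mA A0; have [|||y yA] := @stone_ex [set A].
- by exists A.
- by move=> _ ->.
- by move=> _ _ -> ->; exists A.
- by exists y; apply: yA.
Qed.

(** If each point of a countable set contains measurable sets of arbitrarily
    small measure, then a single set of finite measure belongs to all these
    points: choose in the [n]-th one a set of measure at most [2^-(n+1)] and
    take the union. *)
Lemma stone_countable_small (Y : set stone) : countable Y ->
  (forall y, Y y -> forall e : R, 0 < e -> exists2 A, y A & (mu A <= e%:E)%E) ->
  exists A, [/\ measurable A, (mu A < +oo)%E & forall y, Y y -> y A].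
Proof.
move=> /countable_injP[h hinj] Ysmall.
have /choice[A Aprop] : forall n, exists A : set T, measurable A /\
    (mu A <= (1 / (2 ^ n.+1)%:R)%:E)%E /\
    forall y, Y y -> h y = n -> y A.
  move=> n; have [[y [Yy hy]]|no] := pselect (exists y, Y y /\ h y = n).
    have e0 : (0 < 1 / (2 ^ n.+1)%:R :> R) by rewrite divr_gt0// ltr0n expn_gt0.
    have [A yA mA] := Ysmall y Yy _ e0; exists A; split.
      exact: stone_measurable yA.
    split => // z Yz hz; suff -> : z = y by [].
    by apply: hinj; rewrite ?inE// hz hy.
  exists set0; split => //; split; first by rewrite measure0 lee_fin divr_ge0.
  by move=> y Yy hy; case: no; exists y.
have mA n : measurable (A n) by have [] := Aprop n.
exists (\bigcup_n A n); split.
- exact: bigcup_measurable.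
- apply: (@le_lt_trans _ _ (\sum_(0 <= n <oo) (1 / (2 ^ n.+1)%:R)%:E)%E).
    apply: le_trans (measure_sigma_subadditive _ _ _ (subset_refl _)) _ => //.
      exact: bigcup_measurable.
    by apply: lee_nneseries => // n _; have [_ []] := Aprop n.
  by apply: le_lt_trans (epsilon_trick0 xpredT ler01) _; rewrite ltry.
- move=> y Yy; apply: (@stoneS _ (A (h y))); first exact: bigcup_measurable.
    exact: bigcup_sup.
  by have [_ [_]] := Aprop (h y); apply.
Qed.

End stone_space.

(** * Functional tightness *)

Section tightness.
Set Implicit Arguments.
Unset Strict Implicit.
Variable R : realType.
Local Notation mu := (@lebesgue_measure R).
Local Notation T := (measurableTypeR R).
Local Notation S := (stone mu).

(** A function that is continuous on each [D `|` [set z]], with [D] countable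
    and dense, is continuous: near [x] its value at [z] is close to its value
    at some point of [D] near both [x] and [z], hence to its value at [x]. *)
Lemma separable_functional_tightness (X : topologicalType) (D : set X) :
  countable D -> dense D -> functional_tightness_le R X [set: nat].
Proof.
move=> cD dD f fY.
have fD z : f x @[x --> within (D `|` [set z]) (nbhs z)] --> f z.
  have /subspace_continuousP : {within D `|` [set z], continuous f}.
    apply: fY; rewrite -bigcup2E; apply: bigcup_countable => // i _.
    by case: i => [|[|i]] //=; rewrite /bigcup2/=.
  by apply; right.
move=> x; apply/cvgrPdist_le => e e0.
have e2 : 0 < e / 2 by rewrite divr_gt0.
have /cvgrPdist_le/(_ _ e2) := fD x.
rewrite near_withinE /= nbhsE => -[V [oV Vx] VD].
apply: (@filterS _ _ _ V); last exact: open_nbhs_nbhs.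
move=> z Vz.
have /cvgrPdist_le/(_ _ e2) := fD z.
rewrite near_withinE /= nbhsE => -[W [oW Wz] WD].
have [y [[Vy Wy] Dy]] : (V `&` W) `&` D !=set0.
  by apply: dD; [exists z|exact: openI].
have h1 := VD y Vy (or_introl Dy); have h2 := WD y Wy (or_introl Dy).
have -> : f x - f z = (f x - f y) - (f z - f y) by rewrite opprB addrA subrK.
by rewrite (le_trans (ler_normB _ _))// [leRHS]splitr lerD.
Qed.

(** Lebesgue measure has no atoms: a point that contains a set of finite
    measure either contains a small tail of it, or contains a bounded interval
    and then, by bisection, arbitrarily short intervals. *)
Lemma stone_finite_small (y : S) A (e : R) : y A -> (mu A < +oo)%E -> 0 < e ->
  exists2 B, y B & (mu B <= e%:E)%E.
Proof.
move=> yA Aoo e0; have mA := stone_measurable yA.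
have [[a b] /= ABe] := lebesgue_nearly_bounded mA Aoo e0.
have mAab : measurable (A `\` `[a, b]) by exact: measurableD.
have [?|ny] := pselect (y (A `\` `[a, b])).
  by exists (A `\` `[a, b]); last exact: ltW.
have yab : y `[a, b]%classic.
  apply: (@stoneS _ _ _ _ _ (A `&` ~` (A `\` `[a, b]))) => //.
    move=> x [Ax nAx]; apply: contrapT => nx; exact: nAx.
  by apply: stoneI => //; exact: stoneC.
have bisect k : exists c : R, y `[c, c + (b - a) / 2 ^+ k]%classic.
  elim: k => [|k [c yc]]; first by exists a; rewrite expr0 divr1 subrKC.
  set l := (b - a) / 2 ^+ k in yc.
  have ll : (b - a) / 2 ^+ k.+1 = l / 2.
    by rewrite /l exprSr invfM mulrA.
  rewrite ll; have [yc1|yc1] := pselect (y `[c, c + l / 2]%classic).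
    by exists c.
  have yN : y (~` `[c, c + l / 2]%classic) by apply: stoneC.
  exists (c + l / 2); apply: stoneS (stoneI yc yN) => // x [] /=.
  rewrite !in_itv /=.
  move=> /andP[cx xc] /negP; rewrite cx /= -ltNge => /ltW ->/=.
  by rewrite -addrA -splitr.
have [k hk] : exists k, (b - a) / 2 ^+ k <= e.
  have m0 : 0 < `|b - a| + 1 by rewrite ltr_wpDl.
  have e1 : 0 < e / (`|b - a| + 1) by rewrite divr_gt0.
  have [k _ /(_ k (leqnn k)) /= hk] := near_infty_natSinv_expn_lt (PosNum e1).
  exists k; rewrite ltr_pdivlMr// mul1r mulrC in hk.
  apply: le_trans (ltW hk); rewrite ler_wpM2r ?invr_ge0 ?exprn_ge0//.
  by rewrite (le_trans (ler_norm _))// lerDl.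
have [c yc] := bisect k; exists `[c, c + (b - a) / 2 ^+ k]%classic => //.
rewrite lebesgue_measure_itv/=; case: ifP => _; last by rewrite lee_fin ltW.
by rewrite -EFinB lee_fin addrAC subrr add0r.
Qed.

(** The open set of the points that contain a set of finite measure. It is
    dense and proper, but each of its countable subsets lies in a clopen subset
    of it. *)
Definition finite_part : set S := [set y | exists2 A, y A & (mu A < +oo)%E].

Lemma finite_part_countable (Y : set S) : countable Y ->
  exists A : set T, [/\ measurable A, (mu A < +oo)%E &
    forall y, Y y -> finite_part y -> y A].
Proof.
move=> cY; have [||A [mA Aoo YA]] :=
  @stone_countable_small _ _ _ mu (Y `&` finite_part).
- by apply: sub_countable cY; apply: subset_card_le => ? [].
- by move=> y [_ [A yA Aoo]] e; exact: stone_finite_small yA Aoo.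
- by exists A; split => // y Yy fy; exact: YA.
Qed.

Lemma finite_part_dense : dense finite_part.
Proof.
move=> W [y Wy] oW.
have /nbhs_stone[B yB BW] : nbhs y W by exact: open_nbhs_nbhs.
have mB := stone_measurable yB.
have [k Bk] : exists k : nat, mu (B `&` `[- k%:R, k%:R]%classic) != 0%E.
  apply: contrapT => /forallNP nk.
  have /negP := stone_neq0 yB; apply.
  apply/eqP; apply: measure_negligible => //.
  have -> : B = \bigcup_k (B `&` `[- k%:R, k%:R]%classic).
    apply/seteqP; split => [x Bx|x [k _ []] //].
    exists (Num.truncn `|x|).+1 => //; split => //=.
    by rewrite in_itv /= -ler_norml ltW// truncnS_gt.
  apply: negligible_bigcup => k; apply/negligibleP.
    exact: measurableI.
  by apply/eqP/negPn/negP; exact: nk.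
have mBk : measurable (B `&` `[- k%:R, k%:R]%classic) by exact: measurableI.
have [z zB] := stone_clopen_neq0 mBk Bk.
exists z; split; first by apply: BW; apply: stoneS zB.
exists (B `&` `[- k%:R, k%:R]%classic) => //.
apply: (@le_lt_trans _ _ (mu `[- k%:R, k%:R]%classic)).
  by rewrite le_measure ?inE.
by rewrite lebesgue_measure_itv/=; case: ifP => _; rewrite ?ltry// -EFinB ltry.
Qed.

(** The sets whose complement has finite measure are non-null and stable
    under intersection; a point that contains them all lies outside. *)
Lemma finite_part_neqT : exists y, ~ finite_part y.
Proof.
pose G := [set A : set T | measurable A /\ (mu (~` A) < +oo)%E].
have [|A [mA Aoo]|A B [mA Aoo] [mB Boo]|y Gy] := @stone_ex _ _ _ mu G.
- by exists setT; split => //; rewrite setCT measure0.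
- split => //; apply/eqP => A0; move: Aoo.
  have : (mu [set: T] <= mu A + mu (~` A))%E.
    by rewrite -[X in mu X](setUv A) measureU2//; exact: measurableC.
  rewrite A0 add0e => /le_lt_trans h /h.
  by rewrite -set_itvNyy lebesgue_measure_itv/= ltxx.
- exists (A `&` B) => //; split; first exact: measurableI.
  rewrite setCI (le_lt_trans (measureU2 _ _ _))//; try exact: measurableC.
  exact: lte_add_pinfty.
exists y => -[A yA Aoo]; have mA := stone_measurable yA.
have : y (~` A) by apply: Gy; split; [exact: measurableC|rewrite setCK].
exact: stoneN.
Qed.

(** The witness is the indicator of the complement of [finite_part]. On a
    countable set it coincides with the indicator of the complement of a single
    clopen set. *)
Lemma stone_lebesgue_tightness : ~ functional_tightness_le R S [set: nat].
Proof.
pose f (y : S) : R := if pselect (finite_part y) then 0 else 1.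
move=> /(_ f) fcont.
have {}fcont : continuous f.
  apply: fcont => Y cY.
  have [A [mA Aoo YA]] := finite_part_countable cY.
  pose h (y : S) : R := if pselect (y A) then 0 else 1.
  have hf : {in Y, (h : subspace Y -> R) =1 (f : subspace Y -> R)}.
    move=> y /[1!inE] Yy; rewrite /f /h.
    case: pselect => yA; case: pselect => fy //.
    - by case: fy; exists A.
    - by case: yA; exact: YA.
  apply: (subspace_eq_continuous hf); apply: continuous_subspaceT => y.
  apply: (@near_cst_continuous _ _ (h y)).
  have [yA|yA] := pselect (y A).
    apply: filterS (nbhs_stone_clopen yA) => z zA; rewrite /h.
    by case: pselect => //; case: pselect.
  apply: filterS (nbhs_stone_clopen (stoneC mA yA)) => z zA; rewrite /h.
  case: pselect => zA'; first by have := stoneN zA' zA.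
  by case: pselect.
have [y ny] := finite_part_neqT.
have /cvgrPdist_lt/(_ _ ltr01) := fcont y.
rewrite nbhsE => -[V [oV Vy] VD].
have [z [Vz fz]] : V `&` finite_part !=set0.
  exact: (@finite_part_dense V (ex_intro _ y Vy) oV).
have fy1 : f y = 1 by rewrite /f; case: pselect.
have fz0 : f z = 0 by rewrite /f; case: pselect.
by have := VD z Vz; rewrite /= fy1 fz0 subr0 normr1 ltxx.
Qed.

End tightness.

(** * Density points and affine maps *)

Section density.
Set Implicit Arguments.
Unset Strict Implicit.
Variable R : realType.
Local Notation mu := (@lebesgue_measure R).
Local Notation T := (measurableTypeR R).
Local Notation S := (stone mu).

(** [x] is a point of density 1 of [A]: the proportion of [ball x h] that lies
    outside [A] tends to 0 with [h]. The length [2 * h] of the ball is replaced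
    by [h], which only changes [e] by a factor 2. *)
Definition density_point (A : set T) (x : R) := forall e : R, 0 < e ->
  \forall h \near 0^'+, (mu (ball x h `\` A) <= (e * h)%:E)%E.

Lemma measurable_ball (x h : R) : measurable (ball x h : set T).
Proof. by rewrite ball_itv; exact: measurable_itv. Qed.

Lemma negligible_not_density_point (A : set T) : measurable A ->
  mu.-negligible (A `\` density_point A).
Proof.
move=> mA; have := lebesgue_density mA.
apply: negligibleS => x [Ax nAx] /= dx; apply: nAx => e e0.
have {}dx : ((mu (A `&` ball x r) / mu (ball x r))%E @[r --> 0^'+] -->
    (1 : R)%:E).
  by move: dx; rewrite indicE mem_set.
have e2 : 1 - e / 2 < 1 by rewrite ltrBlDr ltrDl divr_gt0.
have /(fine_cvgP _ _)[dfin /cvgr_gt/(_ _ e2)] := dx.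
move: dfin; apply: filterS3 (nbhs_right_gt 0) => h h0 /=.
have mball := measurable_ball x h.
rewrite lebesgue_measure_ball ?(ltW h0)// => hfin hgt.
have Afin : mu (A `&` ball x h) \is a fin_num.
  rewrite ge0_fin_numE// (@le_lt_trans _ _ (mu (ball x h)))//.
    by rewrite le_measure ?inE//; exact: measurableI.
  by rewrite lebesgue_measure_ball ?(ltW h0)// ltry.
rewrite measureD//=; last by rewrite lebesgue_measure_ball ?(ltW h0)// ltry.
rewrite lebesgue_measure_ball ?(ltW h0)// setIC.
move: hgt; rewrite -(fineK Afin); set m := fine (mu _).
have h2 : 0 < h *+ 2 by rewrite mulrn_wgt0.
rewrite inver gt_eqF// -EFinM /= ltr_pdivlMr// => hm.
by rewrite -EFinB lee_fin; lra.
Qed.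

Lemma density_point_neq0 (A : set T) x : measurable A -> density_point A x ->
  mu A != 0%E.
Proof.
move=> mA dA; apply/eqP => A0.
have [h []] := @filter_ex _ _ _ _ (filterI (dA 1 ltr01) (nbhs_right_gt 0)).
rewrite /= mul1r => + h0.
have mball := measurable_ball x h.
apply/negP; rewrite -ltNge.
rewrite measureD//=; last by rewrite lebesgue_measure_ball ?(ltW h0)// ltry.
have -> : mu (ball x h `&` A) = 0%E.
  apply/eqP; rewrite -measure_le0 -A0 le_measure ?inE//; exact: measurableI.
by rewrite sube0 lebesgue_measure_ball ?(ltW h0)// lte_fin mulr2n ltrDl.
Qed.

(** The choice of such a [y] for each real [x] plays the role of a lifting of
    the measure algebra: [A] belongs to the point chosen at [x] for almost
    every [x] in [A]. *)
Lemma stone_density_point (x : R) : exists y : S,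
  forall A : set T, measurable A -> density_point A x -> y A.
Proof.
pose G := [set A : set T | measurable A /\ density_point A x].
have [|A [mA dA]|A B [mA dA] [mB dB]|y Gy] := @stone_ex _ _ _ mu G.
- exists setT; split => // e e0; near=> h; rewrite setDT measure0 lee_fin.
  by rewrite mulr_ge0// ltW.
- by split => //; exact: density_point_neq0 dA.
- exists (A `&` B) => //; split; first exact: measurableI.
  move=> e e0; have e2 : 0 < e / 2 by rewrite divr_gt0.
  apply: filterS2 (dA _ e2) (dB _ e2) => h hA hB.
  have mball := measurable_ball x h.
  rewrite setDIr (le_trans (measureU2 _ _ _))//; try exact: measurableD.
  by rewrite (le_trans (leeD hA hB))// -EFinD -mulrDl -splitr.
- by exists y => A mA dA; apply: Gy.
Unshelve. all: by end_near. Qed.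

Section affine.
Variables (c d : R).
Let aff (x : T) : T := c * x + d.

Let maff : measurable_fun setT aff.
Proof. exact: measurable_funD. Qed.

Lemma measurable_affine_preimage (A : set T) : measurable A ->
  measurable ((fun x : T => c * x + d) @^-1` A).
Proof. by move=> mA; rewrite -[X in measurable X]setTI; exact: maff. Qed.

Lemma lebesgue_measure_affine_preimage (A : set T) : 0 < c -> measurable A ->
  mu A = (c%:E * mu ((fun x : T => c * x + d)%R @^-1` A))%E.
Proof.
move=> c0 mA; pose c' := NngNum (ltW c0).
have -> : (c%:E * mu (aff @^-1` A))%E = mscale c' (pushforward mu aff) A by [].
apply: lebesgue_measure_unique => // _ [[a b] _ <-] /=.
rewrite /mscale /= /pushforward.
have -> : aff @^-1` `]a, b] = `](a - d) / c, (b - d) / c]%classic.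
  apply/seteqP; split => x; rewrite /= !in_itv /= ltr_pdivrMr// ler_pdivlMr//;
  by rewrite ltrBlDr lerBrDr mulrC.
rewrite !lebesgue_measure_itv /= !lte_fin ltr_pM2r ?invr_gt0// ltrD2r.
case: ifP => _; last by rewrite mule0.
by rewrite -!EFinB -EFinM -mulrBl mulrC divfK ?gt_eqF// opprB addrA subrK.
Qed.

End affine.

(** The affine maps with rational coefficients [q.1] (slope) and [q.2]. With
    positive slope, they map [0, 1] onto the intervals with rational
    endpoints. *)
Definition rat_affine (q : rat * rat) (x : R) : R := ratr q.1 * x + ratr q.2.

(** The points of [0, 1] that the map of coefficients [q] sends outside [A]. *)
Definition affine_avoid (A : set T) (q : rat * rat) : set T :=
  `[0, 1] `&` rat_affine q @^-1` (~` A).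

(** Around a density point of [A] some interval with rational endpoints is
    almost filled by [A]; the affine map onto it sends almost all of [0, 1]
    into [A]. *)
Lemma small_affine_avoid (A : set T) (e : R) : measurable A -> mu A != 0%E ->
  0 < e -> exists2 q : rat * rat, 0 < q.1 &
    measurable (affine_avoid A q) /\ (mu (affine_avoid A q) <= e%:E)%E.
Proof.
move=> mA A0 e0.
have [x dx] : exists x, density_point A x.
  apply: contrapT => /forallNP nd; move/eqP : A0; apply.
  apply: measure_negligible => //.
  by apply: negligibleS (negligible_not_density_point mA) => x Ax; split.
have [h [/= Ah h0]] := @filter_ex _ _ _ _ (filterI (dx e e0) (nbhs_right_gt 0)).
(* The interval [d, d + c] lies in ball x h and its length c is at least h, so
   that the part of it outside A has measure at most e * h <= e * c. *)
have [d /[!in_itv]/= /andP[d1 d2]] : exists d, ratr d \in `]x - h, x - h / 2[.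
  by apply: rat_in_itvoo; lra.
have [c /[!in_itv]/= /andP[c1 c2]] : exists c, ratr c \in `]h, 5 / 4 * h[.
  by apply: rat_in_itvoo; lra.
have c0 : 0 < ratr c :> R by exact: lt_trans c1.
exists (c, d); first by rewrite /= -(@ltr0q R).
pose D : set T := `[ratr d, ratr d + ratr c]%classic `\` A.
have mD : measurable D by exact: measurableD.
have -> : affine_avoid A (c, d) =
    (fun x : T => ratr c * x + ratr d)%R @^-1` D.
  rewrite /D /affine_avoid /rat_affine.
  apply/seteqP; split => y /=; rewrite !in_itv /=.
    move=> [/andP[y0 y1] nA]; split => //.
    by rewrite lerDr addrC lerD2l ger_pMr// y1 mulr_ge0// ltW.
  move=> [/andP[y0 y1] nA]; split => //; move: y0 y1.
  by rewrite lerDr [_ + ratr d]addrC lerD2l pmulr_rge0// ger_pMr// => -> ->.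
split; first exact: measurable_affine_preimage.
rewrite -(@lee_pmul2l _ (ratr c)%:E)// ?lte_fin//.
rewrite -lebesgue_measure_affine_preimage// -EFinM.
apply: (@le_trans _ _ (mu (ball x h `\` A))).
  apply: le_measure; rewrite ?inE//.
    by apply: measurableD => //; exact: measurable_ball.
  move=> y [/=]; rewrite in_itv /= => /andP[y1 y2] nA; split => //.
  by rewrite ball_itv /= in_itv /=; apply/andP; split; lra.
by rewrite (le_trans Ah)// lee_fin mulrC ler_wpM2r// ltW.
Qed.

Lemma negligible_affine_avoid (A : set T) : measurable A -> mu A != 0%E ->
  mu.-negligible (`[0, 1] `&`
    [set x | forall q, 0 < q.1 -> ~ A (rat_affine q x)]).
Proof.
move=> mA A0.
have /choice[q hq] : forall n : nat, exists q : rat * rat, 0 < q.1 /\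
    measurable (affine_avoid A q) /\
    (mu (affine_avoid A q) <= (n.+1%:R^-1)%:E)%E.
  move=> n; have n0 : (0 : R) < n.+1%:R^-1 by rewrite invr_gt0.
  by have [q q0 mq] := small_affine_avoid mA A0 n0; exists q.
have mM : measurable
    (\bigcap_n affine_avoid A (q n)).
  by apply: bigcapT_measurable => n; have [_ []] := hq n.
exists (\bigcap_n affine_avoid A (q n)); split => //.
  apply/eqP; rewrite -measure_le0; apply/lee_addgt0Pr => e e0.
  have [n _ /(_ n (leqnn n)) /= hn] := near_infty_natSinv_lt (PosNum e0).
  have [_ [mq qn]] := hq n; rewrite add0e.
  apply: (@le_trans _ _ (n.+1%:R^-1)%:E); last by rewrite lee_fin ltW.
  by apply: le_trans qn; apply: le_measure; rewrite ?inE//; exact: bigcap_inf.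
by move=> x [x01 xA] n _; split => //; apply: xA; have [] := hq n.
Qed.

Lemma negligible_affine_not_density_point (A : set T) : measurable A ->
  mu A != 0%E -> mu.-negligible (`[0, 1] `&`
    [set x | forall q, 0 < q.1 -> ~ density_point A (rat_affine q x)]).
Proof.
move=> mA A0; have [N [mN N0 AN]] := negligible_not_density_point mA.
have mAN : measurable (A `\` N) by exact: measurableD.
have AN0 : mu (A `\` N) != 0%E.
  apply: contra A0 => /eqP AN0; rewrite -measure_le0.
  rewrite -(adde0 0%E) -[X in (X + _)%E]AN0 -N0.
  apply: le_trans (measureU2 _ _ _) => //.
  apply: le_measure; rewrite ?inE//; first exact: measurableU.
  by move=> x Ax; have [Nx|Nx] := pselect (N x); [right|left].
apply: negligibleS (negligible_affine_avoid mAN AN0) => x [x01 xA].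
split => // q q0 [Aq Nq]; apply: Nq; apply: AN; split => //.
exact: xA.
Qed.

(** * Continuous images of small weight *)

(** Each nonempty [U] in the base contains the image of a clopen set given by a
    non-null [A U]. A real of [0, 1] outside the null sets [N U], which are at
    most omega_1 many, is sent to a density point of each [A U] by some rational
    affine map; the points chosen at its countably many images therefore have
    dense image in [L]. *)
Lemma image_separable (L : topologicalType) (g : S -> L) (B : set (set L)) :
  cov_null_gt_omega1 R -> continuous g -> set_surj setT setT g -> basis B ->
  card_le_omega1 B -> exists2 D : set L, countable D & dense D.
Proof.
move=> hcov gc gsurj [Bo Bb] Bw.
have /choice[A hA] : forall U : set L, exists A : set T,
    B U -> U !=set0 -> [/\ measurable A, mu A != 0%E &
      forall y : S, y A -> U (g y)].
  move=> U; have [[BU [z Uz]]|nU] := pselect (B U /\ U !=set0); last first.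
    by exists set0 => BU U0; case: nU.
  have [y _ gy] := gsurj z I.
  have /nbhs_stone[A yA AU] : nbhs y (g @^-1` U).
    by apply: gc; rewrite gy; apply: open_nbhs_nbhs; split => //; exact: Bo.
  exists A => _ _; split => //.
  - exact: stone_measurable yA.
  - exact: stone_neq0 yA.
pose N (U : set L) : set R := `[0, 1] `&`
  [set x | forall q, 0 < q.1 -> ~ density_point (A U) (rat_affine q x)].
pose F := N @` [set U | B U /\ U !=set0].
have FN : F `<=` null_ideal R.
  move=> _ [U [BU U0] <-]; split; first by move=> x [].
  by have [mA A0 _] := hA U BU U0; exact: negligible_affine_not_density_point.
have Fw : card_le_omega1 F.
  move=> V C nC; apply: card_le_trans (card_image_le _ _) _.
  by apply: card_le_trans (Bw _ _ nC); apply: subset_card_le => U [].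
have [r [r01 rF]] : exists r : R, `[0, 1]%classic r /\
    ~ (\bigcup_(X in F) X) r.
  apply: contrapT => /forallNP nr; apply: (hcov F FN Fw) => r r01.
  by apply: contrapT => rF; apply: (nr r).
have /choice[y hy] := stone_density_point.
exists (range (fun q => g (y (rat_affine q r)))).
  exact: card_le_trans (card_image_le _ _) (countableP _).
move=> W [z Wz] oW.
have [U [BU Uz] UW] : filter_from [set U | B U /\ U z] id W.
  by apply: Bb; apply: open_nbhs_nbhs.
have U0 : U !=set0 by exists z.
have [mA _ AU] := hA U BU U0.
have [q q0 dq] : exists2 q, 0 < q.1 & density_point (A U) (rat_affine q r).
  apply: contrapT => nq; apply: rF; exists (N U); first by exists U.
  by split => // q q0 dq; apply: nq; exists q.
exists (g (y (rat_affine q r))); split; last by exists q.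
by apply: UW; apply: AU; exact: hy.
Qed.

End density.

Theorem theorem5p4 (R : realType) (hcov : cov_null_gt_omega1 R) :
  exists S : topologicalType,
    [/\ hausdorff_space S, compact [set: S],
        ~ functional_tightness_le R S [set: nat] &
        forall L : topologicalType,
          hausdorff_space L -> continuous_image S L -> weight_eq_omega1 L ->
          functional_tightness_eq R L [set: nat]].
Proof.
exists (stone (@lebesgue_measure R)); split.
- exact: hausdorff_stone.
- exact: compact_stone.
- exact: stone_lebesgue_tightness.
- move=> L _ [g gc gsurj] [V [K [[_ Kw] [[B bB BK] _]]]].
  have Bw : card_le_omega1 B.
    by move=> U C nC; rewrite (card_le_eql BK); exact: Kw.
  have [D cD dD] := image_separable hcov gc gsurj bB Bw.
  split; first exact: infinite_nat.
    exact: separable_functional_tightness cD dD.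
  by move=> U K' /infiniteP.
Qed.
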